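(* There exists a mean-payoff game $G$ such that the sequence of requirements $(\lambda_n)_{n\in\mathbb{N}}$ defined by $\lambda_n=\mathsf{nego}^n(\lambda_0)$ is not eventually constant.
   Context: A game is a tuple $G=(\Pi,V,(V_i)_{i\in\Pi},E,\mu)$ with finite player set $\Pi$, directed graph $(V,E)$ in which every vertex has an outgoing edge, partition $(V_i)_{i\in\Pi}$ of $V$ ($V_i$ = vertices of player $i$), and payoff $\mu:V^\omega\to\mathbb{R}^\Pi$. $G$ is a mean-payoff game if $V$ is finite and there are reward functions $r_i:E\to\mathbb{Q}$ such that $\mu_i(\rho)=\liminf_{n\to\infty}\frac1n\sum_{k=0}^{n-1}r_i(\rho_k\rho_{k+1})$ for every play $\rho$. Strategies, profiles, outcomes $\langle\bar\sigma\rangle$ and $\bar\sigma_{\|hv}$ (the profile from $v$ with $\sigma_{j\|hv}(h')=\sigma_j(hh')$) are as usual; $-i=\Pi\setminus\{i\}$. A requirement is a map $\lambda:V\to\overline{\mathbb{R}}$. A play $\rho$ is $\lambda$-consistent if for all $i$, $n$ with $\rho_n\in V_i$, $\mu_i(\rho_{\ge n})\ge\lambda(\rho_n)$. For $v\in V_i$, a profile $\bar\sigma_{-i}$ from $v$ is $\lambda$-rational if there is a strategy $\sigma_i$ such that, with $\bar\sigma=(\bar\sigma_{-i},\sigma_i)$, for every history $hu$ from $v$ compatible with $\bar\sigma_{-i}$, the play $\langle\bar\sigma_{\|hu}\rangle$ is $\lambda$-consistent; $\lambda\mathsf{Rat}(v)$ is the set of such profiles. The negotiation function is $\mathsf{nego}(\lambda)(v)=\inf_{\bar\sigma_{-i}\in\lambda\mathsf{Rat}(v)}\sup_{\sigma_i}\mu_i(\langle\bar\sigma_{-i},\sigma_i\rangle)$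 for $v\in V_i$, with $\inf\emptyset=+\infty$. The vacuous requirement $\lambda_0$ is constantly $-\infty$. *)

(* Defs.v *)
From Stdlib Require Import Reals QArith Qreals List ClassicalEpsilon.
From Coquelicot Require Import Coquelicot.
Import ListNotations.
Open Scope R_scope.

(* A mean-payoff game: finite player set, finite vertex set, owner map
   (the partition (V_i)), edge relation in which every vertex has a
   successor, and rational rewards r_i : E -> Q (given on all pairs of
   vertices; only values on edges ever matter). *)
Record MPGame := {
  Player : Type;
  Vert : Type;
  player_finite : exists l : list Player, forall i, In i l;
  vert_finite : exists l : list Vert, forall v, In v l;
  owner : Vert -> Player;
  edge : Vert -> Vert -> Prop;
  edge_total : forall v, exists w, edge v w;
  reward : Player -> Vert -> Vert -> Q
}.

Section Game.
Variable G : MPGame.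
Notation V := (Vert G).
Notation Pl := (Player G).

Fixpoint psum (i : Pl) (rho : nat -> V) (n : nat) : R :=
  match n with
  | O => 0
  | S n => psum i rho n + Q2R (reward G i (rho n) (rho (S n)))
  end.

Definition mp (i : Pl) (rho : nat -> V) : Rbar :=
  LimInf_seq (fun n => psum i rho n / INR n).

(* A strategy is a map from histories (nonempty lists, chronological) to
   vertices; a strategy for player i must move along an edge from the last
   vertex whenever that vertex belongs to player i. *)
Definition strategy := list V -> V.
Definition valid_strat (i : Pl) (s : strategy) : Prop :=
  forall (h : list V) (x : V), owner G x = i -> edge G x (s (h ++ [x])).

Definition profile := Pl -> strategy.

Definition upd (tau : profile) (i : Pl) (s : strategy) : profile :=
  fun j => if excluded_middle_informative (j = i) then s else tau j.

Fixpoint prefix (sigma : profile) (v : V) (n : nat) : list V :=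
  match n with
  | O => [v]
  | S n => let p := prefix sigma v n in
           p ++ [sigma (owner G (last p v)) p]
  end.

Definition outcome (sigma : profile) (v : V) : nat -> V :=
  fun n => last (prefix sigma v n) v.

Definition shift (sigma : profile) (h : list V) : profile :=
  fun j h' => sigma j (h ++ h').

Definition hist_from (v : V) (l : list V) : Prop :=
  hd_error l = Some v /\
  forall k, (S k < length l)%nat -> edge G (nth k l v) (nth (S k) l v).

Definition compatible (i : Pl) (tau : profile) (v : V) (l : list V) : Prop :=
  forall k, (S k < length l)%nat -> owner G (nth k l v) <> i ->
    nth (S k) l v = tau (owner G (nth k l v)) (firstn (S k) l).

Definition requirement := V -> Rbar.

Definition consistent (lam : requirement) (rho : nat -> V) : Prop :=
  forall n, Rbar_le (lam (rho n)) (mp (owner G (rho n)) (fun k => rho (n + k)%nat)).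

Definition lam_rational (lam : requirement) (v : V) (tau : profile) : Prop :=
  let i := owner G v in
  (forall j, j <> i -> valid_strat j (tau j)) /\
  exists s, valid_strat i s /\
    forall (h : list V) (u : V),
      hist_from v (h ++ [u]) -> compatible i tau v (h ++ [u]) ->
      consistent lam (outcome (shift (upd tau i s) h) u).

Definition nego (lam : requirement) : requirement := fun v =>
  let i := owner G v in
  Rbar_glb (fun x => exists tau : profile, lam_rational lam v tau /\
    x = Rbar_lub (fun y => exists s, valid_strat i s /\
                          y = mp i (outcome (upd tau i s) v))).

Definition lam0 : requirement := fun _ => m_infty.

Definition lam_seq (n : nat) : requirement := Nat.iter n nego lam0.

End Game.

(* Main.v *)
(** Two players each own a hub, from which one moves either to the other hub or
    into one's own sink, where a neutral player mixes freely two kinds of steps.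
    In the sink of [p], a payoff [x] for [p] means [(x + 1) / 2] for his opponent.
    If both hubs require [t], then [p] can run to the other hub, and the worst
    answer consistent with the requirement is to enter the opponent's sink and to
    give the opponent exactly [t] there, hence [(t + 1) / 2] to [p]. So the
    requirement on the hubs is mapped from [t] to [(t + 1) / 2], and its n-th
    iterate is [1 - 2^-n]. *)
Require Import Defs.
From Stdlib Require Import Reals QArith Qreals List ClassicalEpsilon Lra Lia.
From Coquelicot Require Import Coquelicot.
Import ListNotations.
Open Scope R_scope.

(** * Lower limits and mean payoffs *)

Lemma LimInf_seq_ge (u : nat -> R) (c : R) :
  Rbar_le c (LimInf_seq u) <->
  forall eps, 0 < eps ->
    exists N, forall n, (N <= n)%nat -> c - eps < u n.
Proof.
  unfold LimInf_seq; destruct (ex_LimInf_seq u) as [l Hl]; simpl.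
  destruct l as [l| |]; simpl in *; split; try tauto.
  - intros Hc eps Heps.
    destruct (Hl (mkposreal eps Heps)) as [_ [N HN]]; exists N; intros n Hn.
    specialize (HN n Hn); simpl in HN; lra.
  - intros H; apply Rnot_lt_le; intros Hlt.
    assert (Heps : 0 < (c - l) / 2) by lra.
    destruct (H _ Heps) as [N HN].
    destruct (Hl (mkposreal _ Heps)) as [H1 _].
    destruct (H1 N) as [n [Hn Hu]]; specialize (HN n Hn); simpl in Hu; lra.
  - intros _ eps _; destruct (Hl (c - eps)) as [N HN]; now exists N.
  - intros H; destruct (H 1 Rlt_0_1) as [N HN].
    destruct (Hl (c - 1) N) as [n [Hn Hu]]; specialize (HN n Hn); lra.
Qed.

Lemma nat_above (x : R) : exists n : nat, x < INR n.
Proof.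
  destruct (Rle_lt_dec x 0) as [H|H].
  - exists 1%nat; simpl; lra.
  - destruct (archimed_cor1 (/ x)) as [n [Hn Hn0]].
    + now apply Rinv_0_lt_compat.
    + exists n; apply Rinv_lt_cancel; [now apply lt_0_INR | exact Hn].
Qed.

Lemma psum_add (G : MPGame) i rho m n :
  psum G i rho (m + n) = psum G i rho m + psum G i (fun k => rho (m + k)%nat) n.
Proof.
  induction n as [|n IH].
  - rewrite Nat.add_0_r; simpl; lra.
  - rewrite Nat.add_succ_r; simpl; rewrite IH, Nat.add_succ_r; lra.
Qed.

(** After division by the length, the first [N] steps and the constant [C] vanish; [0 < a] keeps the
    direction of the bound on the lower limit. *)
Lemma mp_ge_affine (G : MPGame) i j rho rho' a b C c N :
  0 < a ->
  (forall n, a * psum G j rho' n + b * INR n - C <= psum G i rho (N + n)) ->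
  Rbar_le (Finite c) (mp G j rho') -> Rbar_le (Finite (a * c + b)) (mp G i rho).
Proof.
  intros Ha Hp Hc; unfold mp in *.
  rewrite LimInf_seq_ge in Hc; apply LimInf_seq_ge; intros eps Heps.
  destruct (Hc (eps / (2 * a))) as [N1 HN1].
  { apply Rdiv_lt_0_compat; lra. }
  set (d := a * c + b - eps).
  (* Half of [eps] is spent on [N1]; the other half, over at least [K] steps, absorbs [C] and the
     share [d * INR N] of the first [N] steps. *)
  destruct (nat_above ((C + d * INR N) / (eps / 2))) as [K HK].
  exists (N + (K + N1) + 1)%nat; intros n Hn.
  assert (Hm : exists m, n = (N + m)%nat /\ (K <= m)%nat /\ (N1 <= m)%nat /\ (0 < m)%nat).
  { exists (n - N)%nat; lia. }
  destruct Hm as [m [-> [HKm [HNm Hm0]]]].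
  specialize (HN1 m HNm); specialize (Hp m).
  assert (Hm : 0 < INR m) by now apply lt_0_INR.
  assert (HNm' : 0 < INR (N + m)) by (apply lt_0_INR; lia).
  apply le_INR in HKm.
  apply (Rmult_lt_compat_r (INR m)) in HN1; trivial.
  replace (psum G j rho' m / INR m * INR m) with (psum G j rho' m) in HN1
    by (field; lra).
  apply (Rmult_lt_compat_l a) in HN1; trivial.
  replace (a * ((c - eps / (2 * a)) * INR m)) with ((a * c - eps / 2) * INR m)
    in HN1 by (field; lra).
  apply (Rmult_lt_compat_r (eps / 2)) in HK; [|lra].
  replace ((C + d * INR N) / (eps / 2) * (eps / 2)) with (C + d * INR N) in HK
    by (field; lra).
  assert (INR K * (eps / 2) <= INR m * (eps / 2))
    by (apply Rmult_le_compat_r; lra).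
  apply (Rmult_lt_reg_r (INR (N + m))); trivial.
  replace (psum G i rho (N + m) / INR (N + m) * INR (N + m))
    with (psum G i rho (N + m)) by (field; lra).
  fold d; rewrite plus_INR; unfold d in *; lra.
Qed.

Lemma mp_eq_of_bounded (G : MPGame) i rho c C N :
  (forall n, Rabs (psum G i rho (N + n) - c * INR n) <= C) ->
  mp G i rho = Finite c.
Proof.
  intros H; unfold mp; apply is_LimInf_seq_unique, is_lim_LimInf_seq.
  (* Counting from the start of the play instead of from [N] costs at most [Rabs c * INR N]. *)
  set (D := C + Rabs c * INR N).
  assert (H' : forall n, (N <= n)%nat -> Rabs (psum G i rho n - c * INR n) <= D).
  { intros n Hn; replace n with (N + (n - N))%nat by lia.
    specialize (H (n - N)%nat).
    replace (psum G i rho (N + (n - N)) - c * INR (N + (n - N)))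
      with ((psum G i rho (N + (n - N)) - c * INR (n - N)) + - (c * INR N))
      by (rewrite (plus_INR N); lra).
    eapply Rle_trans; [apply Rabs_triang|].
    rewrite Rabs_Ropp, Rabs_mult, (Rabs_pos_eq (INR N)) by apply pos_INR.
    unfold D; lra. }
  apply is_lim_seq_spec; intros eps; simpl.
  destruct (nat_above (D / eps)) as [K HK].
  exists (N + K + 1)%nat; intros n Hn.
  assert (Hn0 : 0 < INR n) by (apply lt_0_INR; lia).
  assert (HKn : INR K <= INR n) by (apply le_INR; lia).
  specialize (H' n ltac:(lia)).
  replace (psum G i rho n / INR n - c)
    with ((psum G i rho n - c * INR n) / INR n) by (field; lra).
  unfold Rdiv at 1; rewrite Rabs_mult, Rabs_inv, (Rabs_pos_eq (INR n)) by lra.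
  apply (Rmult_lt_reg_r (INR n)); trivial.
  rewrite Rmult_assoc, Rinv_l, Rmult_1_r by lra.
  destruct eps as [eps Heps]; simpl in *.
  apply (Rmult_lt_compat_r eps) in HK; trivial.
  replace (D / eps * eps) with D in HK by (field; lra).
  assert (INR K * eps <= INR n * eps) by (apply Rmult_le_compat_r; lra).
  lra.
Qed.

(** * Outcomes, histories and changes of strategy *)

Lemma outcome_S (G : MPGame) sigma v n :
  outcome G sigma v (S n) =
  sigma (owner G (outcome G sigma v n)) (prefix G sigma v n).
Proof. unfold outcome at 1; simpl; now rewrite last_last. Qed.

Lemma prefix_length (G : MPGame) sigma v n : length (prefix G sigma v n) = S n.
Proof.
  induction n as [|n IH]; simpl; trivial.
  rewrite length_app, IH; simpl; lia.
Qed.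

Lemma prefix_snoc (G : MPGame) sigma v n :
  exists h, prefix G sigma v n = h ++ [outcome G sigma v n].
Proof.
  destruct n as [|n]; [now exists []|].
  exists (prefix G sigma v n); rewrite outcome_S; reflexivity.
Qed.

Lemma firstn_prefix (G : MPGame) sigma v m k :
  (k <= m)%nat -> firstn (S k) (prefix G sigma v m) = prefix G sigma v k.
Proof.
  intros Hk; induction Hk as [|m Hk IH].
  - apply firstn_all2; rewrite prefix_length; lia.
  - change (prefix G sigma v (S m)) with
      (prefix G sigma v m ++ [sigma (owner G (outcome G sigma v m)) (prefix G sigma v m)]).
    rewrite firstn_app, prefix_length.
    replace (S k - S m)%nat with 0%nat by lia.
    rewrite firstn_O, app_nil_r; exact IH.
Qed.

Lemma nth_prefix (G : MPGame) sigma v d m k :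
  (k <= m)%nat -> nth k (prefix G sigma v m) d = outcome G sigma v k.
Proof.
  intros Hk.
  assert (H : nth k (firstn (S k) (prefix G sigma v m)) d = outcome G sigma v k).
  { rewrite (firstn_prefix G sigma v m k Hk).
    destruct (prefix_snoc G sigma v k) as [h Hh].
    pose proof (prefix_length G sigma v k) as Hl.
    rewrite Hh in *; rewrite length_app in Hl; simpl in Hl.
    rewrite app_nth2 by lia.
    replace (k - length h)%nat with 0%nat by lia; reflexivity. }
  rewrite <- H, nth_firstn.
  replace (k <? S k)%nat with true; trivial.
  symmetry; apply Nat.ltb_lt; lia.
Qed.

Lemma upd_same (G : MPGame) tau i s : upd G tau i s i = s.
Proof. unfold upd; destruct (excluded_middle_informative _); congruence. Qed.

Lemma upd_other (G : MPGame) tau i s j : j <> i -> upd G tau i s j = tau j.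
Proof. intros; unfold upd; destruct (excluded_middle_informative _); congruence. Qed.

Lemma edge_outcome (G : MPGame) sigma v n :
  (forall j, valid_strat G j (sigma j)) ->
  edge G (outcome G sigma v n) (outcome G sigma v (S n)).
Proof.
  intros Hs; rewrite outcome_S.
  destruct (prefix_snoc G sigma v n) as [h ->]; now apply Hs.
Qed.

Lemma valid_upd (G : MPGame) tau i s :
  (forall j, j <> i -> valid_strat G j (tau j)) -> valid_strat G i s ->
  forall j, valid_strat G j (upd G tau i s j).
Proof.
  intros Ht Hs j; destruct (excluded_middle_informative (j = i)) as [->|Hj].
  - now rewrite upd_same.
  - rewrite upd_other; auto.
Qed.

Lemma hist_from_prefix (G : MPGame) sigma v n :
  (forall j, valid_strat G j (sigma j)) ->
  hist_from G v (prefix G sigma v n).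
Proof.
  intros Hs; split.
  - induction n as [|n IH]; simpl; trivial.
    destruct (prefix G sigma v n); [discriminate | exact IH].
  - intros k Hk; rewrite prefix_length in Hk.
    rewrite !nth_prefix by lia; now apply edge_outcome.
Qed.

Lemma compatible_prefix (G : MPGame) tau i s v n :
  compatible G i tau v (prefix G (upd G tau i s) v n).
Proof.
  intros k Hk; rewrite prefix_length in Hk.
  rewrite !nth_prefix, firstn_prefix by lia; intros Ho.
  now rewrite outcome_S, upd_other.
Qed.

(* A continuation that never visits a vertex of [i] does not depend on the
   strategy of [i]. *)
Lemma outcome_shift_upd (G : MPGame) tau i s s' v m h :
  prefix G (upd G tau i s) v m = h ++ [outcome G (upd G tau i s) v m] ->
  (forall k, owner G (outcome G (upd G tau i s) v (m + k)) <> i) ->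
  forall k, outcome G (upd G tau i s) v (m + k) =
    outcome G (shift G (upd G tau i s') h) (outcome G (upd G tau i s) v m) k.
Proof.
  intros Hh Hi.
  set (u := outcome G (upd G tau i s) v m) in *.
  (* Strategies read whole histories, so the induction must carry the prefixes along with the
     current vertices. *)
  assert (Hp : forall k, prefix G (upd G tau i s) v (m + k) =
    h ++ prefix G (shift G (upd G tau i s') h) u k /\
    outcome G (upd G tau i s) v (m + k) =
    outcome G (shift G (upd G tau i s') h) u k).
  { intros k; induction k as [|k [IHp IHo]].
    - rewrite Nat.add_0_r; split; [exact Hh | reflexivity].
    - specialize (Hi k).
      assert (Hx : outcome G (upd G tau i s) v (m + S k) =
        outcome G (shift G (upd G tau i s') h) u (S k)).
      { rewrite Nat.add_succ_r, !outcome_S.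
        rewrite <- IHo; unfold shift at 1; rewrite <- IHp, !upd_other; trivial. }
      split; trivial.
      change (prefix G (shift G (upd G tau i s') h) u (S k)) with
        (prefix G (shift G (upd G tau i s') h) u k ++
         [shift G (upd G tau i s') h
            (owner G (outcome G (shift G (upd G tau i s') h) u k))
            (prefix G (shift G (upd G tau i s') h) u k)]).
      rewrite <- outcome_S, <- Hx, app_assoc, <- IHp.
      rewrite Nat.add_succ_r, outcome_S; reflexivity. }
  intros k; apply Hp.
Qed.

(** * Bounding the negotiation function *)

Lemma nego_le (G : MPGame) lam v tau c :
  lam_rational G lam v tau ->
  (forall s, valid_strat G (owner G v) s ->
     Rbar_le (mp G (owner G v) (outcome G (upd G tau (owner G v) s) v)) c) ->
  Rbar_le (nego G lam v) c.
Proof.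
  intros Ht Hc.
  eapply Rbar_le_trans.
  - apply (proj1 (proj2_sig (Rbar_ex_glb _))); exists tau.
    split; [exact Ht | reflexivity].
  - apply (proj2 (proj2_sig (Rbar_ex_lub _))); intros y [s [Hs ->]]; auto.
Qed.

Lemma nego_ge (G : MPGame) lam v c :
  (forall tau, lam_rational G lam v tau ->
     exists s, valid_strat G (owner G v) s /\
     Rbar_le c (mp G (owner G v) (outcome G (upd G tau (owner G v) s) v))) ->
  Rbar_le c (nego G lam v).
Proof.
  intros Hc; apply (proj2 (proj2_sig (Rbar_ex_glb _))); intros x [tau [Ht ->]].
  destruct (Hc tau Ht) as [s [Hs Hle]].
  eapply Rbar_le_trans; [exact Hle|].
  apply (proj1 (proj2_sig (Rbar_ex_lub _))); now exists s.
Qed.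

(** * The game with two hubs and two sinks *)

(** The sink of [p] is a pair of vertices: [q] records the kind of step just made, so that rewards
    can depend on the target alone. *)
Inductive vertex := Hub (p : bool) | Sink (p q : bool).

(* [Hub p] is owned by [Some p], the sinks by the neutral player [None]. *)
Definition vertex_owner (v : vertex) : option bool :=
  match v with Hub p => Some p | Sink _ _ => None end.

Definition vertex_edge (v w : vertex) : Prop :=
  match v, w with
  | Hub p, Hub r => r = negb p
  | Hub p, Sink r _ => r = p
  | Sink p _, Sink r _ => r = p
  | Sink _ _, Hub _ => False
  end.

(* Chosen so that along edges into [Sink p _] the reward [y] of [negb p] and
   the reward [x] of [p] satisfy [y = (x + 1) / 2]. *)
Definition vertex_reward (i : option bool) (v w : vertex) : Q :=
  match i, w with
  | None, _ => 0
  | Some _, Hub _ => 1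
  | Some _, Sink _ true => 1
  | Some j, Sink p false => if Bool.eqb j p then 0 else 1 # 2
  end.

Lemma option_bool_finite : exists l : list (option bool), forall i, In i l.
Proof. exists [None; Some true; Some false]; intros [[]|]; simpl; auto. Qed.

Lemma vertex_finite : exists l : list vertex, forall v, In v l.
Proof.
  exists [Hub true; Hub false; Sink true true; Sink true false;
          Sink false true; Sink false false].
  intros [[]|[] []]; simpl; tauto.
Qed.

Lemma vertex_edge_total v : exists w, vertex_edge v w.
Proof. destruct v as [p|p q]; exists (Sink p true); reflexivity. Qed.

Definition hub_game : MPGame :=
  {| player_finite := option_bool_finite; vert_finite := vertex_finite;
     owner := vertex_owner; edge_total := vertex_edge_total;
     reward := vertex_reward |}.

(** Consequently a requirement of at most 0 on the sinks never restricts the neutral player. *)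
Lemma mp_None rho : mp hub_game None rho = Finite 0.
Proof.
  apply (mp_eq_of_bounded _ _ _ 0 0 0); intros n.
  replace (psum hub_game None rho (0 + n)) with 0.
  - rewrite Rmult_0_l, Rminus_0_r, Rabs_R0; lra.
  - induction n as [|n IH]; simpl in *; trivial.
    rewrite <- IH; unfold Q2R; simpl; lra.
Qed.

(** Rewards are nonnegative, so the payoff dominates that of the neutral player. This lets the
    iteration start as if from 0 instead of minus infinity. *)
Lemma mp_nonneg i rho : Rbar_le (Finite 0) (mp hub_game i rho).
Proof.
  rewrite <- (mp_None rho).
  apply LimInf_le; exists 1%nat; intros n Hn.
  assert (0 < INR n) by (apply lt_0_INR; lia).
  apply Rmult_le_compat_r; [left; now apply Rinv_0_lt_compat|].
  clear H Hn; induction n as [|n IH]; [simpl; lra|].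
  cbn [psum]; apply Rplus_le_compat; trivial; simpl.
  apply Qle_Rle; destruct i as [[]|], (rho (S n)) as [|[] []]; discriminate.
Qed.

(** The relation between the two rewards holds edge by edge; [rho 0] may still be the hub from which
    the sink is entered. *)
Lemma psum_sink_other r rho n :
  (forall k, exists q, rho (S k) = Sink r q) ->
  psum hub_game (Some (negb r)) rho n =
  (psum hub_game (Some r) rho n + INR n) / 2.
Proof.
  intros H; induction n as [|n IH]; [simpl; lra|].
  rewrite S_INR; cbn [psum]; rewrite IH.
  destruct (H n) as [q ->]; simpl.
  destruct r, q; unfold Q2R; simpl; lra.
Qed.

(** * The lower bound *)

(* Player [p] always moves to the other hub. If [negb p] ever leaves for
   [Sink (negb p)], rationality guarantees him [t] there, hence [(t + 1) / 2]
   to [p]; otherwise the play stays in the hubs and pays 1. *)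
Lemma nego_hub_ge lam t p :
  t <= 1 ->
  (forall x, Rbar_le (Finite 0) x -> Rbar_le (lam (Hub (negb p))) x ->
     Rbar_le (Finite t) x) ->
  Rbar_le (Finite ((t + 1) / 2)) (nego hub_game lam (Hub p)).
Proof.
  intros Ht Hlam; apply nego_ge; intros tau [Hval [s0 [Hs0 Hcons]]].
  cbn [owner hub_game vertex_owner] in *.
  exists (fun _ => Hub (negb p)); set (s := fun _ : list vertex => Hub (negb p)).
  assert (Hs : valid_strat hub_game (Some p) s).
  { intros h [r|r q]; simpl; intros Hx; [now injection Hx as -> | discriminate]. }
  split; trivial.
  set (rho := outcome hub_game (upd hub_game tau (Some p) s) (Hub p)).
  change (Rbar_le (Finite ((t + 1) / 2)) (mp hub_game (Some p) rho)).
  assert (Hedge : forall k, vertex_edge (rho k) (rho (S k))).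
  { intros k; apply (edge_outcome hub_game); apply valid_upd; trivial. }
  destruct (excluded_middle_informative (forall k, exists r, rho k = Hub r))
    as [Hhub|Hsink].
  - assert (Hm : mp hub_game (Some p) rho = Finite 1).
    { apply (mp_eq_of_bounded _ _ _ 1 0 0); intros n.
      replace (psum hub_game (Some p) rho (0 + n)) with (INR n).
      - rewrite Rmult_1_l, Rminus_diag, Rabs_R0; lra.
      - simpl; induction n as [|n IH]; trivial.
        rewrite S_INR; cbn [psum]; rewrite <- IH.
        destruct (Hhub (S n)) as [r ->]; unfold Q2R; simpl; lra. }
    rewrite Hm; simpl; lra.
  - assert (Hex : exists m r r' q, rho m = Hub r /\ rho (S m) = Sink r' q).
    { apply Classical_Prop.NNPP; intros Hno; apply Hsink; intros k.
      induction k as [|k [r IH]]; [now exists p|].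
      destruct (rho (S k)) as [r'|r' q] eqn:E; [now exists r'|].
      exfalso; apply Hno; now exists k, r, r', q. }
    destruct Hex as [m [r [r' [q [Hm HSm]]]]].
    pose proof (Hedge m) as He; rewrite Hm, HSm in He; simpl in He; subst r'.
    assert (Hr : r = negb p).
    { destruct (Bool.bool_dec r p) as [->|Hr]; [|now destruct r, p].
      exfalso; unfold rho in HSm; rewrite outcome_S in HSm; fold rho in HSm.
      rewrite Hm in HSm; simpl in HSm; rewrite upd_same in HSm; discriminate. }
    subst r.
    assert (Htail : forall k, exists q', rho (m + S k)%nat = Sink (negb p) q').
    { induction k as [|k [q' IH]].
      - exists q; now rewrite Nat.add_1_r.
      - pose proof (Hedge (m + S k)%nat) as He; rewrite IH in He.
        rewrite Nat.add_succ_r.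
        destruct (rho (S (m + S k))) as [|r q'']; simpl in He; [easy|].
        subst r; now exists q''. }
    destruct (prefix_snoc hub_game (upd hub_game tau (Some p) s) (Hub p) m)
      as [h Hh].
    (* Rationality is witnessed by [s0], whereas [rho] is played with [s]. The history up to [m] is
       compatible with [tau], so the continuation with [s0] is consistent; it is also the tail of
       [rho], because [p] owns no vertex from [m] on. *)
    assert (Hc : consistent hub_game lam
      (outcome hub_game (shift hub_game (upd hub_game tau (Some p) s0) h) (rho m))).
    { pose proof (hist_from_prefix hub_game _ (Hub p) m
        (valid_upd hub_game tau (Some p) s Hval Hs)) as Hhist.
      pose proof (compatible_prefix hub_game tau (Some p) s (Hub p) m) as Hcomp.
      rewrite Hh in Hhist, Hcomp; exact (Hcons h (rho m) Hhist Hcomp). }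
    assert (Hown : forall k, owner hub_game (rho (m + k)%nat) <> Some p).
    { intros [|k].
      - rewrite Nat.add_0_r, Hm; simpl; destruct p; discriminate.
      - destruct (Htail k) as [q' ->]; discriminate. }
    pose proof (outcome_shift_upd hub_game tau (Some p) s s0 (Hub p) m h Hh Hown)
      as Heq; fold rho in Heq.
    set (rho' := outcome hub_game (shift hub_game (upd hub_game tau (Some p) s0) h)
                   (rho m)) in *.
    assert (Ht' : Rbar_le (Finite t) (mp hub_game (Some (negb p)) rho')).
    { apply Hlam; [apply mp_nonneg|].
      specialize (Hc 0%nat); simpl in Hc.
      replace (rho' 0%nat) with (Hub (negb p)) in Hc by (symmetry; exact Hm).
      exact Hc. }
    (* Both coefficients come from [psum_sink_other]; the constant absorbs the rewards collected
       before step [m]. *)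
    replace ((t + 1) / 2) with (/ 2 * t + / 2) by field.
    apply (mp_ge_affine hub_game (Some p) (Some (negb p)) rho rho' (/ 2) (/ 2)
             (Rabs (psum hub_game (Some p) rho m)) t m); trivial; [lra|].
    intros n; rewrite psum_add.
    assert (Hps : psum hub_game (Some p) (fun k => rho (m + k)%nat) n =
                  psum hub_game (Some p) rho' n).
    { induction n as [|n IH]; trivial; cbn [psum]; rewrite IH, !Heq; trivial. }
    rewrite Hps.
    pose proof (psum_sink_other (negb p) rho' n) as Ho.
    rewrite Bool.negb_involutive in Ho; rewrite Ho.
    + pose proof (Rle_abs (- psum hub_game (Some p) rho m)) as Ha.
      rewrite Rabs_Ropp in Ha; lra.
    + intros k; rewrite <- Heq; apply Htail.
Qed.

(** * The upper bound *)

(* Partial sums of the greedy 0-1 sequence of average [t]. *)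
Fixpoint greedy_sum (t : R) (n : nat) : R :=
  match n with
  | O => 0
  | S n => greedy_sum t n +
           (if Rle_dec (greedy_sum t n + 1) (t * INR (S n)) then 1 else 0)
  end.

Definition greedy_bit (t : R) (n : nat) : bool :=
  if Rle_dec (greedy_sum t n + 1) (t * INR (S n)) then true else false.

(** Refusing a 1 means that the sum already exceeds [t * INR (S n) - 1]; granting it adds 1, at
    least the increase [t] of the lower bound. *)
Lemma greedy_sum_bounds t n :
  0 <= t <= 1 -> t * INR n - 1 <= greedy_sum t n <= t * INR n.
Proof.
  intros Ht; induction n as [|n IH]; [simpl; lra|].
  cbn [greedy_sum]; destruct (Rle_dec _ _) as [H|H];
    rewrite S_INR in *; lra.
Qed.

(** [c] is the phase at which the greedy sequence starts to be read. *)
Lemma psum_greedy t r rho c n :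
  (forall k, rho (S k) = Sink r (greedy_bit t (c + k))) ->
  psum hub_game (Some r) rho n = greedy_sum t (c + n) - greedy_sum t c.
Proof.
  intros Hrho; induction n as [|n IH].
  - rewrite Nat.add_0_r; simpl; lra.
  - rewrite (Nat.add_succ_r c); cbn [greedy_sum psum]; rewrite IH, Hrho.
    unfold greedy_bit; destruct (Rle_dec _ _); simpl;
      rewrite ?Bool.eqb_reflx; unfold Q2R; simpl; lra.
Qed.

(** Every window of length [n] of the greedy sequence sums to [t * INR n] up to 1, so neither the
    phase [c] nor the first [N] steps change the averages. *)
Lemma mp_greedy t r rho N c :
  0 <= t <= 1 ->
  (forall k, rho (N + S k)%nat = Sink r (greedy_bit t (c + k))) ->
  mp hub_game (Some r) rho = Finite t /\
  mp hub_game (Some (negb r)) rho = Finite ((t + 1) / 2).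
Proof.
  intros Ht Hrho.
  assert (H : forall n, Rabs (greedy_sum t (c + n) - greedy_sum t c - t * INR n) <= 1).
  { intros n; apply Rabs_le.
    pose proof (greedy_sum_bounds t (c + n) Ht) as H1.
    pose proof (greedy_sum_bounds t c Ht) as H2.
    rewrite plus_INR in H1; lra. }
  split.
  - apply (mp_eq_of_bounded _ _ _ _ (Rabs (psum hub_game (Some r) rho N) + 1) N).
    intros n; rewrite psum_add, (psum_greedy t r (fun k => rho (N + k)%nat) c) by apply Hrho.
    unfold Rminus at 1; rewrite Rplus_assoc.
    eapply Rle_trans; [apply Rabs_triang|]; apply Rplus_le_compat_l, H.
  - set (A := psum hub_game (Some (negb r)) rho N).
    apply (mp_eq_of_bounded _ _ _ _ (Rabs A + 1) N).
    intros n; rewrite psum_add,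
      (psum_sink_other r (fun k => rho (N + k)%nat)) by (intros k; rewrite Hrho; eauto).
    rewrite (psum_greedy t r (fun k => rho (N + k)%nat) c) by apply Hrho; fold A.
    specialize (H n); apply Rabs_le_between in H.
    match goal with |- Rabs ?x <= _ => replace x with
      (A + (greedy_sum t (c + n) - greedy_sum t c - t * INR n) / 2) by lra end.
    eapply Rle_trans; [apply Rabs_triang|].
    apply Rplus_le_compat_l, Rabs_le; lra.
Qed.

(** One rule for all players: its clause at [Hub p] is the cooperative answer of [p] that makes the
    punishing profile rational. *)
Definition punish_step (t : R) (p : bool) (v : vertex) (n : nat) : vertex :=
  match v with
  | Hub r => if Bool.eqb r p then Hub (negb p) else Sink r (greedy_bit t n)
  | Sink r _ => Sink r (greedy_bit t n)
  end.

(* Against [p]: [negb p] leaves for his sink at once, where the neutral player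
   gives him exactly the average [t]. The length of the history is the clock. *)
Definition punish (t : R) (p : bool) (h : list vertex) : vertex :=
  punish_step t p (last h (Hub p)) (length h).

Lemma punish_valid t p j : valid_strat hub_game j (punish t p).
Proof.
  intros h x _; unfold punish; simpl; rewrite last_last.
  destruct x as [r|r q]; simpl; trivial.
  destruct (Bool.eqb r p) eqn:E; simpl; trivial.
  apply Bool.eqb_prop in E; now subst.
Qed.

(** The clock runs on across the shift: [length h] vertices, then the [S n] of the current
    prefix. *)
Lemma outcome_punish t p sigma h u n :
  sigma (vertex_owner (outcome hub_game (shift hub_game sigma h) u n)) = punish t p ->
  outcome hub_game (shift hub_game sigma h) u (S n) =
  punish_step t p (outcome hub_game (shift hub_game sigma h) u n) (S (length h) + n).
Proof.
  intros Hs; rewrite outcome_S; unfold shift at 1; cbn [owner hub_game].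
  rewrite Hs; unfold punish; rewrite length_app, prefix_length, Nat.add_succ_r.
  destruct (prefix_snoc hub_game (shift hub_game sigma h) u n) as [h' ->].
  now rewrite app_assoc, last_last.
Qed.

Definition region (v : vertex) : bool := match v with Hub r | Sink r _ => r end.

Lemma punish_tail t p rho c m :
  (forall n, rho n <> Hub p -> rho (S n) = punish_step t p (rho n) (c + n)) ->
  rho m <> Hub p ->
  forall k, rho (m + S k)%nat = Sink (region (rho m)) (greedy_bit t (c + m + k)).
Proof.
  intros Hrho Hm k; induction k as [|k IH].
  - rewrite Nat.add_1_r, (Hrho m Hm), Nat.add_0_r.
    destruct (rho m) as [r|r q]; simpl; trivial.
    destruct (Bool.eqb r p) eqn:E; trivial.
    apply Bool.eqb_prop in E; now subst.
  - rewrite Nat.add_succ_r, Hrho; rewrite IH; [|discriminate].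
    simpl; do 2 f_equal; lia.
Qed.

(** When everybody follows the rule, the owner of [Hub (negb p)] gets exactly [t] from there, and
    [p] gets [(t + 1) / 2 >= t] from [Hub p] through the other hub. This holds after every history,
    whoever owns [v]. *)
Lemma punish_rational lam t p v :
  0 <= t <= 1 ->
  (forall r, Rbar_le (lam (Hub r)) (Finite t)) ->
  (forall r q, Rbar_le (lam (Sink r q)) (Finite 0)) ->
  lam_rational hub_game lam v (fun _ => punish t p).
Proof.
  intros Ht Hhub Hsink; split; [intros; apply punish_valid|].
  exists (punish t p); split; [apply punish_valid|]; intros h u _ _.
  set (sigma := upd _ _ _ _).
  assert (Hsig : forall j, sigma j = punish t p).
  { intros j; unfold sigma, upd; now destruct (excluded_middle_informative _). }
  set (rho := outcome hub_game (shift hub_game sigma h) u).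
  assert (Hrho : forall n, rho (S n) = punish_step t p (rho n) (S (length h) + n)).
  { intros n; apply outcome_punish, Hsig. }
  intros n; cbn [owner hub_game].
  destruct (rho n) as [r|r q] eqn:E; cbn [vertex_owner].
  - destruct (Bool.bool_dec r p) as [->|Hr].
    + assert (HSn : rho (S n) = Hub (negb p)).
      { rewrite Hrho, E; simpl; now rewrite Bool.eqb_reflx. }
      pose proof (punish_tail t p rho _ (S n) (fun n _ => Hrho n)) as Htl.
      rewrite HSn in Htl.
      assert (Hne : Hub (negb p) <> Hub p) by (destruct p; discriminate).
      specialize (Htl Hne).
      destruct (mp_greedy t (negb p) (fun k => rho (n + k)%nat) 1
        (S (length h) + S n) Ht) as [_ Hmp].
      { intros k; rewrite <- Htl; f_equal; lia. }
      rewrite Bool.negb_involutive in Hmp; rewrite Hmp.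
      eapply Rbar_le_trans; [apply Hhub|]; simpl; lra.
    + pose proof (punish_tail t p rho _ n (fun n _ => Hrho n)) as Htl.
      rewrite E in Htl.
      destruct (mp_greedy t r (fun k => rho (n + k)%nat) 0
        (S (length h) + n) Ht) as [Hmp _].
      { intros k; apply Htl; congruence. }
      rewrite Hmp; apply Hhub.
  - rewrite mp_None; apply Hsink.
Qed.

(** Only the first move of [p] counts: his own sink pays him [t], the other hub [(t + 1) / 2]. *)
Lemma nego_hub_le lam t p :
  0 <= t <= 1 ->
  (forall r, Rbar_le (lam (Hub r)) (Finite t)) ->
  (forall r q, Rbar_le (lam (Sink r q)) (Finite 0)) ->
  Rbar_le (nego hub_game lam (Hub p)) (Finite ((t + 1) / 2)).
Proof.
  intros Ht Hhub Hsink; apply (nego_le hub_game _ _ (fun _ => punish t p));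
    [now apply punish_rational|].
  cbn [owner hub_game vertex_owner]; intros s Hs.
  set (sigma := upd _ _ _ _).
  set (rho := outcome hub_game sigma (Hub p)).
  assert (Hrho : forall n, rho n <> Hub p -> rho (S n) = punish_step t p (rho n) (1 + n)).
  { intros n Hn; apply (outcome_punish t p sigma [] (Hub p) n).
    unfold sigma; apply (upd_other hub_game); fold sigma.
    change (shift hub_game sigma []) with sigma; fold rho.
    destruct (rho n); simpl; congruence. }
  assert (Hedge : vertex_edge (Hub p) (rho 1%nat)).
  { apply (edge_outcome hub_game sigma (Hub p) 0), valid_upd; trivial.
    intros; apply punish_valid. }
  pose proof (punish_tail t p rho 1 1 Hrho) as Htl.
  destruct (rho 1%nat) as [r|r q]; simpl in Hedge; subst r.
  - destruct (mp_greedy t (negb p) rho 1 2 Ht) as [_ Hmp].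
    { intros k; apply Htl; destruct p; discriminate. }
    rewrite Bool.negb_involutive in Hmp; rewrite Hmp; apply Rbar_le_refl.
  - destruct (mp_greedy t p rho 1 2 Ht) as [Hmp _].
    { intros k; apply Htl; discriminate. }
    rewrite Hmp; simpl; lra.
Qed.

(** The neutral player always gets 0, but a rational profile must be exhibited, since the infimum of
    the empty set is plus infinity. *)
Lemma nego_sink_le lam t r q :
  0 <= t <= 1 ->
  (forall r, Rbar_le (lam (Hub r)) (Finite t)) ->
  (forall r q, Rbar_le (lam (Sink r q)) (Finite 0)) ->
  Rbar_le (nego hub_game lam (Sink r q)) (Finite 0).
Proof.
  intros Ht Hhub Hsink; apply (nego_le hub_game _ _ (fun _ => punish t true));
    [now apply punish_rational|].
  intros s _; cbn [owner hub_game vertex_owner]; rewrite mp_None.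
  apply Rbar_le_refl.
Qed.

(** * The iterates of the negotiation function *)

(** The closed form starts at index 1, as [lam0] is minus infinity. The bound on the sinks is
    carried along to keep the punishing profile rational. *)
Lemma lam_seq_hub_game n :
  (forall r, lam_seq hub_game (S n) (Hub r) = Finite (1 - (/ 2) ^ S n)) /\
  (forall r q, Rbar_le (lam_seq hub_game (S n) (Sink r q)) (Finite 0)).
Proof.
  assert (Hstep : forall lam t, 0 <= t <= 1 ->
    (forall r, Rbar_le (lam (Hub r)) (Finite t)) ->
    (forall r q, Rbar_le (lam (Sink r q)) (Finite 0)) ->
    (forall r x, Rbar_le (Finite 0) x -> Rbar_le (lam (Hub r)) x ->
       Rbar_le (Finite t) x) ->
    (forall r, nego hub_game lam (Hub r) = Finite ((t + 1) / 2)) /\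
    (forall r q, Rbar_le (nego hub_game lam (Sink r q)) (Finite 0))).
  { intros lam t Ht Hhub Hsink Hge; split.
    - intros r; apply Rbar_le_antisym; [now apply nego_hub_le|].
      apply nego_hub_ge; [lra | apply Hge].
    - intros r q; now apply (nego_sink_le lam t). }
  induction n as [|n [IHhub IHsink]].
  (* [lam0] acts as the value 0 on the hubs: it lies below 0, and payoffs are nonnegative. *)
  - replace (1 - (/ 2) ^ 1) with ((0 + 1) / 2) by field.
    apply (Hstep (lam0 hub_game)); simpl; trivial; lra.
  - assert (Hpow : 0 < (/ 2) ^ S n) by (apply pow_lt; lra).
    assert (Hpow1 : (/ 2) ^ S n <= 1).
    { rewrite <- (pow1 (S n)); apply pow_incr; lra. }
    replace (1 - (/ 2) ^ S (S n)) with ((1 - (/ 2) ^ S n + 1) / 2)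
      by (rewrite <- (tech_pow_Rmult _ (S n)); field).
    apply (Hstep (lam_seq hub_game (S n))); trivial; [lra | |].
    + intros r; rewrite IHhub; apply Rbar_le_refl.
    + intros r x _; now rewrite IHhub.
Qed.

Theorem mainTheorem5 :
  exists G : MPGame,
    ~ (exists N : nat, forall n : nat, (N <= n)%nat ->
         forall v : Vert G, lam_seq G n v = lam_seq G N v).
Proof.
  exists hub_game; intros [N HN].
  (* Indices [S N] and [S (S N)] are in the range of the closed form; the values there differ by
     [(/ 2) ^ S (S N)]. *)
  assert (H : lam_seq hub_game (S (S N)) (Hub true) =
              lam_seq hub_game (S N) (Hub true)).
  { transitivity (lam_seq hub_game N (Hub true)); [|symmetry]; apply HN; lia. }
  rewrite (proj1 (lam_seq_hub_game (S N))), (proj1 (lam_seq_hub_game N)) in H.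
  apply (f_equal real) in H; cbn [real] in H.
  assert (0 < (/ 2) ^ S N) by (apply pow_lt; lra).
  rewrite <- (tech_pow_Rmult _ (S N)) in H; lra.
Qed.
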